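(* Let $w=\sqrt{(s-2)(2s+1)(2s^2+s+2)}$. The functions $$T_{37}=\frac12+\frac{3(2s+1)(32s^7+32s^6+138s^5+25s^4+130s^3+30s^2+20s-10)}{2(s-2)^2(4s+1)^2(2s^2+s+2)\,w},$$ $$y_{37}=\frac12+\frac{(2s+1)(256s^8-832s^7-800s^6-3232s^5-1844s^4-2950s^3-1436s^2-391s+64)}{2\,w\,(4s+1)(64s^6+336s^4+104s^3+36s^2-132s-59)}$$ (with the same branch of $w$ in both) parametrize an algebraic solution $y_{37}(T_{37})$ of the sixth Painlev\'e equation $P_{VI}(1/3,1/3,1/3,1/5;T_{37})$.
   Context: $P_{VI}(\theta_0,\theta_1,\theta_T,\theta_\infty;T)$ denotes the sixth Painlev\'e equation $$\begin{aligned}\frac{d^2y}{dT^2}={}&\frac12\left(\frac1y+\frac1{y-1}+\frac1{y-T}\right)\left(\frac{dy}{dT}\right)^2-\left(\frac1T+\frac1{T-1}+\frac1{y-T}\right)\frac{dy}{dT}\\&+\frac{y(y-1)(y-T)}{T^2(T-1)^2}\left(\alpha+\beta\frac{T}{y^2}+\gamma\frac{T-1}{(y-1)^2}+\delta\frac{T(T-1)}{(y-T)^2}\right)\end{aligned}$$ for $y=y(T)$, with $\alpha=\frac{(\theta_\infty-1)^2}{2}$, $\beta=-\frac{\theta_0^2}{2}$, $\gamma=\frac{\theta_1^2}{2}$, $\delta=\frac{1-\theta_T^2}{2}$. That functions $T$ and $y$ on the algebraic curve with coordinates $(s,w)$ parametrize a solution means that $T$ is non-constant and that $y$, viewed locally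 as a function of $T$, satisfies the equation. *)

(* Defs.v *)
From Stdlib Require Import Reals List.
From Coquelicot Require Import Coquelicot.
Open Scope R_scope.
Open Scope C_scope.

(* [t], [y], [y1], [y2] stand for T, y, dy/dT and d^2y/dT^2.  Division on [C] is
   total, so the conditions under which every quotient below is a genuine one are
   part of the equation. *)
Definition PVI (th0 th1 thT thoo : C) (t y y1 y2 : C) : Prop :=
  let alpha := (thoo - 1) ^ 2 / 2 in
  let beta := - (th0 ^ 2 / 2) in
  let gamma := th1 ^ 2 / 2 in
  let delta := (1 - thT ^ 2) / 2 in
  t <> 0 /\ t <> 1 /\ y <> 0 /\ y <> 1 /\ y <> t /\
  y2 = 1 / 2 * (1 / y + 1 / (y - 1) + 1 / (y - t)) * y1 ^ 2
     - (1 / t + 1 / (t - 1) + 1 / (y - t)) * y1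
     + y * (y - 1) * (y - t) / (t ^ 2 * (t - 1) ^ 2)
       * (alpha + beta * (t / y ^ 2) + gamma * ((t - 1) / (y - 1) ^ 2)
          + delta * (t * (t - 1) / (y - t) ^ 2)).

(* [is_derive] is taken over the field [C], so [Y] is holomorphic near [t0]. *)
Definition PVI_solution_near (th0 th1 thT thoo : C) (Y : C -> C) (t0 : C) : Prop :=
  exists Y1 Y2 : C -> C,
    locally t0 (fun t : C =>
      is_derive Y t (Y1 t) /\ is_derive Y1 t (Y2 t) /\
      PVI th0 th1 thT thoo t (Y t) (Y1 t) (Y2 t)).

(* A curve is given by its set of points in [C * C].  Rational functions on it are
   given by total functions whose values at poles and at points of indeterminacy
   are junk; these points are finite in number, so statements about such functions
   are made up to a finite exceptional set. *)
Definition almost_all (X : C * C -> Prop) (P : C * C -> Prop) : Prop :=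
  exists E : list (C * C), forall p, X p -> ~ In p E -> P p.

Definition nonconstant_on (X : C * C -> Prop) (T : C * C -> C) : Prop :=
  ~ exists c : C, almost_all X (fun p => T p = c).

(* "[y], viewed locally as a function of [T]" is the function [Y] with [y = Y o T]
   on the curve near the given point.  Its existence is part of the claim. *)
Definition parametrizes_PVI_solution (th0 th1 thT thoo : C)
    (X : C * C -> Prop) (T y : C * C -> C) : Prop :=
  nonconstant_on X T /\
  almost_all X (fun p =>
    exists Y : C -> C,
      locally p (fun q => X q -> y q = Y (T q)) /\
      PVI_solution_near th0 th1 thT thoo Y (T p)).

(* When [T] is non-constant, such a relation must involve [y], so [y] is an
   algebraic function of [T]. *)
Definition algebraically_related_on (X : C * C -> Prop) (T y : C * C -> C) : Prop :=
  exists (N : nat) (a : nat -> nat -> C),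
    (exists i j : nat, (i <= N)%nat /\ (j <= N)%nat /\ a i j <> 0) /\
    almost_all X (fun p =>
      sum_n (fun i => sum_n (fun j => a i j * T p ^ i * y p ^ j) N) N = RtoC 0).

Definition curve37 (p : C * C) : Prop :=
  let (s, w) := p in w ^ 2 = (s - 2) * (2 * s + 1) * (2 * s ^ 2 + s + 2).

Definition T37 (p : C * C) : C :=
  let (s, w) := p in
  1 / 2
  + 3 * (2 * s + 1)
    * (32 * s ^ 7 + 32 * s ^ 6 + 138 * s ^ 5 + 25 * s ^ 4 + 130 * s ^ 3
       + 30 * s ^ 2 + 20 * s - 10)
    / (2 * (s - 2) ^ 2 * (4 * s + 1) ^ 2 * (2 * s ^ 2 + s + 2) * w).

Definition y37 (p : C * C) : C :=
  let (s, w) := p in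
  1 / 2
  + (2 * s + 1)
    * (256 * s ^ 8 - 832 * s ^ 7 - 800 * s ^ 6 - 3232 * s ^ 5 - 1844 * s ^ 4
       - 2950 * s ^ 3 - 1436 * s ^ 2 - 391 * s + 64)
    / (2 * w * (4 * s + 1)
       * (64 * s ^ 6 + 336 * s ^ 4 + 104 * s ^ 3 + 36 * s ^ 2 - 132 * s - 59)).

(* Main.v *)
Require Import Defs.
From Stdlib Require Import Reals ZArith Lra Lia List FinFun ClassicalEpsilon.
From Coquelicot Require Import Coquelicot.
Import ListNotations.
Open Scope R_scope.
Open Scope C_scope.

(** Put [tau = T - 1/2].  The sign change [w -> - w] of the curve sends [(T, y)] to
    [(1 - T, 1 - y)], a symmetry of this Painleve equation because its first two
    parameters agree.  Hence [tau ^ 2], the quotient [(y - 1/2) / tau] and the slope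
    [dy/dT] are rational functions of [s] alone, called [tau2], [ratio] and [slope] below,
    and [w] never has to be differentiated.

    Near a point where [tau2' s <> 0], the map [tau2] has a holomorphic local inverse
    ([local_inverse], [strictly_diff_inverse]).  Composed with [t -> (t - 1/2) ^ 2] it
    gives [s] as a holomorphic function [S] of [t = T], and then
    [Y t = 1/2 + (t - 1/2) * ratio (S t)], with [Y' = slope (S t)] by the chain rule.  The
    equation is odd in [tau]; multiplied by [tau] it becomes an identity between rational
    functions of [s] ([PVI_symmetric], [PVI_at]).  All this holds where the polynomial [bad]
    does not vanish, that is, off finitely many points of the curve ([almost_all_good]).

    [T] takes the values [1/2 + tau] and [1/2 - tau] at conjugate points, so it could be
    constant only if [tau] vanished ([T37_nonconstant]).

    The algebraic relation comes from counting dimensions.  After multiplication by a fixed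
    power of a common denominator, the [(N + 1) ^ 2] monomials [T ^ i * y ^ j] with
    [i, j <= N] all lie in a space of functions [P(s) + tau * Q(s)] whose dimension grows
    only linearly in [N], hence are linearly dependent for large [N]
    ([algebraic_dependence]). *)

(** * Discs and continuity in the complex plane *)

Lemma Cmod_minus_sym (a b : C) : Cmod (a - b) = Cmod (b - a).
Proof. rewrite <- (Cmod_opp (b - a)). f_equal. ring. Qed.

Lemma ball_Cmod (x y : C) (d : posreal) :
  (Cmod (y - x) < d)%R -> ball x d y.
Proof.
  intros H. pose proof (Rmax_Cmod (y - x)) as Hm.
  pose proof (Rmax_l (Rabs (fst (y - x))) (Rabs (snd (y - x)))).
  pose proof (Rmax_r (Rabs (fst (y - x))) (Rabs (snd (y - x)))).
  split; unfold ball; simpl; unfold AbsRing_ball, abs, minus, plus, opp; simpl in *; lra.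
Qed.

Lemma Cmod_ball (x y : C) (d : posreal) :
  ball x d y -> (Cmod (y - x) < 2 * d)%R.
Proof.
  intros [H1 H2].
  unfold ball in H1, H2; simpl in H1, H2.
  unfold AbsRing_ball, abs, minus, plus, opp in H1, H2; simpl in H1, H2.
  pose proof (Cmod_2Rmax (y - x)%C) as Hm.
  assert (Hs : (sqrt 2 < 2)%R).
  { rewrite <- (sqrt_pow2 2) at 2 by lra. apply sqrt_lt_1; lra. }
  assert (Hr : (Rmax (Rabs (fst (y - x)%C)) (Rabs (snd (y - x)%C)) < d)%R)
    by (apply Rmax_lub_lt; assumption).
  assert (H0 : (0 <= Rmax (Rabs (fst (y - x)%C)) (Rabs (snd (y - x)%C)))%R)
    by (eapply Rle_trans; [apply Rabs_pos | apply Rmax_l]).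
  pose proof (sqrt_pos 2). nra.
Qed.

(** The uniform structure on [C] is that of the product of two real lines; the estimates
    below need round discs. *)
Lemma locally_Cmod (x : C) (P : C -> Prop) :
  locally x P <-> exists d : R, (0 < d)%R /\ forall y, (Cmod (y - x) < d)%R -> P y.
Proof.
  split.
  - intros [d Hd]. exists d. split. apply cond_pos.
    intros y Hy. apply Hd, ball_Cmod, Hy.
  - intros (d & Hd & H). exists (mkposreal (d / 2) ltac:(lra)).
    intros y Hy. apply H. apply Cmod_ball in Hy. simpl in Hy. lra.
Qed.

Lemma locally_pair_Cmod (x y : C) (P : C * C -> Prop) :
  locally (x, y) P ->
  exists d : R, (0 < d)%R /\
    forall a b, (Cmod (a - x) < d)%R -> (Cmod (b - y) < d)%R -> P (a, b).
Proof.
  intros [d Hd]. exists d. split. apply cond_pos.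
  intros a b Ha Hb. apply Hd. split; apply ball_Cmod; assumption.
Qed.

Lemma continuous_Cmult {T : UniformSpace} (f g : T -> C) (x : T) :
  continuous f x -> continuous g x -> continuous (fun t => f t * g t) x.
Proof.
  intros Hf Hg P HP.
  apply (continuous_mult (K := C_AbsRing) f g x).
  - intros Q HQ. apply Hf, locally_C, HQ.
  - intros Q HQ. apply Hg, locally_C, HQ.
  - apply locally_C, HP.
Qed.

Lemma continuous_Cplus {T : UniformSpace} (f g : T -> C) (x : T) :
  continuous f x -> continuous g x -> continuous (fun t => f t + g t) x.
Proof. exact (continuous_plus (V := C_NormedModule) f g x). Qed.

Lemma Cmod_triangle_minus (a b c : C) : (Cmod (a - c) <= Cmod (a - b) + Cmod (b - c))%R.
Proof. replace (a - c) with ((a - b) + (b - c)) by ring. apply Cmod_triangle. Qed.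

Lemma continuous_Cinv (x : C) : x <> 0 -> continuous Cinv x.
Proof.
  intros Hx P HP. apply locally_Cmod in HP. destruct HP as (e & He & HP).
  assert (Hm : (0 < Cmod x)%R) by (apply Cmod_gt_0; exact Hx).
  unfold filtermap. apply locally_Cmod.
  exists (Rmin (Cmod x / 2) (e * (Cmod x * Cmod x) / 2)). split.
  { apply Rmin_glb_lt; [lra|]. apply Rmult_lt_0_compat; [|lra].
    apply Rmult_lt_0_compat; [lra | nra]. }
  intros y Hy. apply HP.
  pose proof (Rmin_l (Cmod x / 2) (e * (Cmod x * Cmod x) / 2)).
  pose proof (Rmin_r (Cmod x / 2) (e * (Cmod x * Cmod x) / 2)).
  assert (Hy2 : (Cmod x / 2 < Cmod y)%R).
  { pose proof (Cmod_triangle (x - y) y) as Ht.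
    replace (x - y + y) with x in Ht by ring.
    rewrite Cmod_minus_sym in Ht. lra. }
  assert (Hy0 : y <> 0) by (apply Cmod_gt_0; lra).
  replace (/ y - / x) with ((x - y) / (y * x)) by (field; auto).
  rewrite Cmod_div by (apply Cmult_neq_0; assumption).
  rewrite Cmod_mult, Cmod_minus_sym.
  apply Rlt_div_l; [nra|].
  apply Rlt_le_trans with (e * (Cmod x * Cmod x) / 2)%R; [lra|].
  assert (Cmod x * Cmod x / 2 <= Cmod y * Cmod x)%R by nra. nra.
Qed.

Lemma continuous_Cinv_comp {T : UniformSpace} (f : T -> C) (x : T) :
  continuous f x -> f x <> 0 -> continuous (fun t => / f t) x.
Proof.
  intros Hf Hx. apply (continuous_comp f Cinv); [exact Hf | apply continuous_Cinv, Hx].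
Qed.

(** * Strict differentiability *)

(** Strict differentiability, through a difference quotient [phi] that is continuous at the
    point of the diagonal (Caratheodory).  In this form the rules of calculus are algebra
    with difference quotients, and an estimate of [f a - f b] for two moving points, which
    the inverse function theorem needs, is available without a mean value theorem. *)
Definition strictly_diff (f : C -> C) (x l : C) : Prop :=
  exists phi : C * C -> C,
    locally (x, x) (fun ab => f (fst ab) - f (snd ab) = phi ab * (fst ab - snd ab)) /\
    continuous phi (x, x) /\ phi (x, x) = l.

Lemma continuous_fst_comp (f : C -> C) (x y : C) :
  continuous f x -> continuous (fun ab : C * C => f (fst ab)) (x, y).
Proof. intros Hf. apply (continuous_comp fst f); [apply continuous_fst | exact Hf]. Qed.

Lemma continuous_snd_comp (f : C -> C) (x y : C) :
  continuous f y -> continuous (fun ab : C * C => f (snd ab)) (x, y).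
Proof. intros Hf. apply (continuous_comp snd f); [apply continuous_snd | exact Hf]. Qed.

Lemma continuous_map_pair (f : C -> C) (x y : C) :
  continuous f x -> continuous f y ->
  continuous (fun ab : C * C => (f (fst ab), f (snd ab))) (x, y).
Proof.
  intros Hx Hy P [d Hd].
  assert (H1 : locally (x, y) (fun ab : C * C => ball (M := C_UniformSpace) (f x) d (f (fst ab)))).
  { apply (continuous_fst_comp f x y Hx (ball (M := C_UniformSpace) (f x) d)), locally_ball. }
  assert (H2 : locally (x, y) (fun ab : C * C => ball (M := C_UniformSpace) (f y) d (f (snd ab)))).
  { apply (continuous_snd_comp f x y Hy (ball (M := C_UniformSpace) (f y) d)), locally_ball. }
  unfold filtermap. generalize (filter_and _ _ H1 H2). apply filter_imp.
  intros ab [H3 H4]. apply Hd. split; assumption.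
Qed.

Lemma strictly_diff_continuous (f : C -> C) (x l : C) :
  strictly_diff f x l -> continuous f x.
Proof.
  intros (phi & Hphi & Hc & _).
  assert (Hx : continuous (fun a : C => (a, x)) x).
  { intros P [d Hd]. exists d. intros y Hy. apply Hd. split; [exact Hy | apply ball_center]. }
  apply continuous_ext_loc with (fun a => phi (a, x) * (a - x) + f x).
  - specialize (Hx _ Hphi). unfold filtermap in Hx. revert Hx. apply filter_imp.
    intros a Ha. simpl in Ha. rewrite <- Ha. change (f a - f x + f x = f a). ring.
  - apply continuous_Cplus; [apply continuous_Cmult | apply continuous_const].
    + apply (continuous_comp (fun a : C => (a, x)) phi); assumption.
    + apply continuous_Cplus; [apply continuous_id | apply continuous_const].
Qed.

Lemma strictly_diff_eq (f : C -> C) (x l l' : C) :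
  strictly_diff f x l -> l = l' -> strictly_diff f x l'.
Proof. intros H <-. exact H. Qed.

Lemma strictly_diff_const (c x : C) : strictly_diff (fun _ => c) x 0.
Proof.
  exists (fun _ => 0). split; [|split; [apply continuous_const | reflexivity]].
  apply filter_forall. intros [a b]; simpl. ring.
Qed.

Lemma strictly_diff_id (x : C) : strictly_diff (fun s => s) x 1.
Proof.
  exists (fun _ => 1). split; [|split; [apply continuous_const | reflexivity]].
  apply filter_forall. intros [a b]; simpl. ring.
Qed.

Lemma strictly_diff_plus (f g : C -> C) (x l m : C) :
  strictly_diff f x l -> strictly_diff g x m ->
  strictly_diff (fun s => f s + g s) x (l + m).
Proof.
  intros (phi & Hf & Cf & <-) (psi & Hg & Cg & <-).
  exists (fun ab => phi ab + psi ab).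
  split; [|split; [apply continuous_Cplus; assumption | reflexivity]].
  generalize (filter_and _ _ Hf Hg). apply filter_imp.
  intros [a b] [H1 H2]; simpl in *.
  transitivity ((f a - f b) + (g a - g b)); [ring | rewrite H1, H2; ring].
Qed.

Lemma strictly_diff_mult (f g : C -> C) (x l m : C) :
  strictly_diff f x l -> strictly_diff g x m ->
  strictly_diff (fun s => f s * g s) x (l * g x + f x * m).
Proof.
  intros Sf Sg.
  pose proof (strictly_diff_continuous _ _ _ Sf) as Kf.
  pose proof (strictly_diff_continuous _ _ _ Sg) as Kg.
  destruct Sf as (phi & Hf & Cf & <-), Sg as (psi & Hg & Cg & <-).
  exists (fun ab => phi ab * g (fst ab) + f (snd ab) * psi ab).
  split; [|split; [|reflexivity]].
  - generalize (filter_and _ _ Hf Hg). apply filter_imp.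
    intros [a b] [H1 H2]; simpl in *.
    transitivity ((f a - f b) * g a + f b * (g a - g b));
      [ring | rewrite H1, H2; ring].
  - apply continuous_Cplus; apply continuous_Cmult; try assumption.
    + apply continuous_fst_comp, Kg.
    + apply continuous_snd_comp, Kf.
Qed.

Lemma locally_neq0 {T : UniformSpace} (f : T -> C) (x : T) :
  continuous f x -> f x <> 0 -> locally x (fun t => f t <> 0).
Proof.
  intros Hf Hx. apply (Hf (fun z : C => z <> 0)). apply locally_Cmod.
  exists (Cmod (f x)). split; [apply Cmod_gt_0, Hx|].
  intros y Hy ->. rewrite Cmod_minus_sym in Hy.
  replace (f x - 0) with (f x) in Hy by ring. lra.
Qed.

Lemma strictly_diff_inv (f : C -> C) (x l : C) :
  strictly_diff f x l -> f x <> 0 ->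
  strictly_diff (fun s => / f s) x (- l / f x ^ 2).
Proof.
  intros Sf Hx. pose proof (strictly_diff_continuous _ _ _ Sf) as Kf.
  destruct Sf as (phi & Hf & Cf & <-).
  pose proof (continuous_fst_comp f x x Kf) as K1.
  pose proof (continuous_snd_comp f x x Kf) as K2.
  exists (fun ab => phi ab * (- (1)) * (/ f (fst ab) * / f (snd ab))).
  split; [|split].
  - generalize (filter_and _ _ Hf
      (filter_and _ _ (locally_neq0 _ _ K1 Hx) (locally_neq0 _ _ K2 Hx))).
    apply filter_imp. intros [a b] (H1 & H2 & H3); simpl in *.
    transitivity (- (f a - f b) * (/ f a * / f b)); [field; auto | rewrite H1; field; auto].
  - apply continuous_Cmult; [apply continuous_Cmult; [assumption | apply continuous_const]|].
    apply continuous_Cmult; apply continuous_Cinv_comp; assumption.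
  - simpl. field. exact Hx.
Qed.

Lemma strictly_diff_minus (f g : C -> C) (x l m : C) :
  strictly_diff f x l -> strictly_diff g x m ->
  strictly_diff (fun s => f s - g s) x (l - m).
Proof.
  intros (phi & Hf & Cf & <-) (psi & Hg & Cg & <-).
  exists (fun ab => phi ab - psi ab).
  split; [|split; [exact (continuous_minus (V := C_NormedModule) _ _ _ Cf Cg) | reflexivity]].
  generalize (filter_and _ _ Hf Hg). apply filter_imp.
  intros [a b] [H1 H2]; simpl in *.
  transitivity ((f a - f b) - (g a - g b)); [ring | rewrite H1, H2; ring].
Qed.

Lemma strictly_diff_div (f g : C -> C) (x l m : C) :
  strictly_diff f x l -> strictly_diff g x m -> g x <> 0 ->
  strictly_diff (fun s => f s / g s) x ((l * g x - f x * m) / g x ^ 2).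
Proof.
  intros Sf Sg Hx. eapply strictly_diff_eq.
  - exact (strictly_diff_mult f (fun s => / g s) x _ _ Sf (strictly_diff_inv _ _ _ Sg Hx)).
  - cbv beta. field. exact Hx.
Qed.

Lemma strictly_diff_opp (f : C -> C) (x l : C) :
  strictly_diff f x l -> strictly_diff (fun s => - f s) x (- l).
Proof.
  intros (phi & Hf & Cf & <-). exists (fun ab => - phi ab).
  split; [|split; [exact (continuous_opp (V := C_NormedModule) _ _ Cf) | reflexivity]].
  revert Hf. apply filter_imp. intros [a b] H1; simpl in *.
  transitivity (- (f a - f b)); [ring | rewrite H1; ring].
Qed.

Lemma strictly_diff_pow (f : C -> C) (x l : C) (n : nat) :
  strictly_diff f x l ->
  strictly_diff (fun s => f s ^ n) x (IZR (Z.of_nat n) * f x ^ pred n * l).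
Proof.
  intros Sf. induction n as [|n IH].
  - eapply strictly_diff_eq; [exact (strictly_diff_const 1 x) | simpl; ring].
  - eapply strictly_diff_eq; [apply (strictly_diff_mult f (fun s => f s ^ n) _ _ _ Sf IH)|].
    rewrite Nat2Z.inj_succ, succ_IZR, RtoC_plus. destruct n as [|n]; simpl; ring.
Qed.

Lemma strictly_diff_comp (f g : C -> C) (x l m : C) :
  strictly_diff g x m -> strictly_diff f (g x) l ->
  strictly_diff (fun s => f (g s)) x (l * m).
Proof.
  intros Sg (phi & Hf & Cf & <-). pose proof (strictly_diff_continuous _ _ _ Sg) as Kg.
  destruct Sg as (psi & Hg & Cg & <-).
  assert (Kgg : continuous (fun ab : C * C => (g (fst ab), g (snd ab))) (x, x)).
  { apply continuous_map_pair; assumption. }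
  exists (fun ab => phi (g (fst ab), g (snd ab)) * psi ab).
  split; [|split; [|reflexivity]].
  - generalize (filter_and _ _ Hg (Kgg _ Hf)). apply filter_imp.
    intros [a b] [H1 H2]; simpl in *. rewrite H2, H1. ring.
  - apply continuous_Cmult; [|assumption].
    apply (continuous_comp (fun ab : C * C => (g (fst ab), g (snd ab))) phi); assumption.
Qed.

Lemma strictly_diff_is_derive (f : C -> C) (x l : C) :
  strictly_diff f x l -> is_derive f x l.
Proof.
  intros (phi & Hf & Cf & <-).
  split; [apply is_linear_scal_l|].
  intros y Hy. apply (is_filter_lim_locally_unique (V := AbsRing_NormedModule C_AbsRing)) in Hy.
  subst y. intros eps.
  apply locally_C.
  assert (Hx : continuous (fun a : C => (a, x)) x).
  { intros P [d Hd]. exists d. intros y Hy. apply Hd. split; [exact Hy | apply ball_center]. }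
  assert (Hc : continuous (fun a => phi (a, x)) x)
    by (apply (continuous_comp (fun a : C => (a, x)) phi); assumption).
  assert (He : locally x (fun a => (Cmod (phi (a, x) - phi (x, x)) < eps)%R)).
  { apply (Hc (fun z : C => (Cmod (z - phi (x, x)) < eps)%R)). apply locally_Cmod.
    exists eps. split; [apply cond_pos | auto]. }
  assert (Hbound : forall a : C, (Cmod (phi (a, x) - phi (x, x)) < eps)%R ->
    f a - f x = phi (a, x) * (a - x) ->
    (Cmod (f a - f x - (a - x) * phi (x, x)) <= eps * Cmod (a - x))%R).
  { intros a H1 H2. rewrite H2.
    replace (phi (a, x) * (a - x) - (a - x) * phi (x, x))
      with ((phi (a, x) - phi (x, x)) * (a - x)) by ring.
    rewrite Cmod_mult. apply Rmult_le_compat_r; [apply Cmod_ge_0 | lra]. }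
  generalize (filter_and _ _ He (Hx _ Hf)). apply filter_imp.
  intros a [H1 H2]. exact (Hbound a H1 H2).
Qed.

(** * The holomorphic inverse function theorem *)

(** The iterates of [x] satisfy [|u (n + 1) - u n| <= d / 4 * (1 / 2) ^ n], so they stay
    within [d / 2] of [x] and converge. *)
Lemma half_contraction_fixed_point (N : C -> C) (x : C) (d : R) :
  (0 < d)%R ->
  (forall a b, (Cmod (a - x) < d)%R -> (Cmod (b - x) < d)%R ->
     (Cmod (N a - N b) <= Cmod (a - b) / 2)%R) ->
  (Cmod (N x - x) < d / 4)%R ->
  exists s, (Cmod (s - x) < d)%R /\ N s = s.
Proof.
  intros Hd HN Hx.
  pose (u := fix u n := match n with O => x | S n => N (u n) end).
  assert (Hu : forall n, (Cmod (u n - x) <= d / 2 * (1 - (1 / 2) ^ n))%R /\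
                         (Cmod (u (S n) - u n) <= d / 4 * (1 / 2) ^ n)%R).
  { induction n as [|n [IH1 IH2]].
    - simpl. split; [|lra]. replace (x - x) with (RtoC 0) by ring. rewrite Cmod_0. lra.
    - assert (Hp : (0 < (1 / 2) ^ n)%R) by (apply pow_lt; lra).
      assert (H1 : (Cmod (u (S n) - x) <= d / 2 * (1 - (1 / 2) ^ S n))%R).
      { pose proof (Cmod_triangle_minus (u (S n)) (u n) x). simpl pow. nra. }
      assert (Hp' : (0 < (1 / 2) ^ S n)%R) by (apply pow_lt; lra).
      split; [exact H1|].
      assert (H2 := HN (u (S n)) (u n) ltac:(nra) ltac:(nra)).
      change (u (S (S n))) with (N (u (S n))). change (u (S n)) with (N (u n)) at 2.
      simpl pow. lra. }
  assert (Hc : forall n k,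
    (Cmod (u (n + k)%nat - u n) <= d / 2 * (1 / 2) ^ n * (1 - (1 / 2) ^ k))%R).
  { intros n. assert (Hp : (0 < (1 / 2) ^ n)%R) by (apply pow_lt; lra).
    induction k as [|k IH].
    - rewrite Nat.add_0_r. replace (u n - u n) with (RtoC 0) by ring. rewrite Cmod_0. simpl. lra.
    - rewrite Nat.add_succ_r.
      pose proof (Cmod_triangle_minus (u (S (n + k))) (u (n + k)%nat) (u n)).
      pose proof (proj2 (Hu (n + k)%nat)) as H2. rewrite pow_add in H2. simpl pow. nra. }
  assert (Hsmall : forall e, (0 < e)%R -> exists n, (d / 2 * (1 / 2) ^ n < e)%R).
  { intros e He. destruct (pow_lt_1_zero (1 / 2) ltac:(rewrite Rabs_pos_eq; lra) (e / d)) as [n Hn].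
    { apply Rdiv_lt_0_compat; lra. }
    exists n. specialize (Hn n (le_n n)).
    assert (Hp : (0 < (1 / 2) ^ n)%R) by (apply pow_lt; lra).
    rewrite Rabs_pos_eq in Hn by lra. apply Rlt_div_r in Hn; [nra | lra]. }
  pose (F := filtermap u eventually).
  assert (HF : ProperFilter F) by (apply filtermap_proper_filter; apply eventually_filter).
  assert (Hlim := C_complete_ax1 F HF).
  set (s := C_complete_lim F) in Hlim.
  assert (Hs : forall e, (0 < e)%R -> exists n, (Cmod (u n - s) < e /\ Cmod (u (S n) - s) < e)%R).
  { intros e He.
    destruct (Hlim) with (eps := mkposreal (e / 2) ltac:(lra)) as [n Hn].
    - intros eps. destruct (Hsmall eps (cond_pos eps)) as [n Hn].
      exists (u n). exists n. intros m Hm. apply ball_Cmod.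
      replace m with (n + (m - n))%nat by lia.
      assert (Hp : (0 < (1 / 2) ^ n)%R) by (apply pow_lt; lra).
      assert (Hp' : (0 < (1 / 2) ^ (m - n))%R) by (apply pow_lt; lra).
      specialize (Hc n (m - n)%nat).
      eapply Rle_lt_trans; [exact Hc|]. eapply Rle_lt_trans; [|exact Hn].
      assert (0 < d / 2 * (1 / 2) ^ n)%R by nra. nra.
    - exists n. split.
      + replace e with (2 * (e / 2))%R by field.
        exact (Cmod_ball _ _ _ (Hn n (le_n n))).
      + replace e with (2 * (e / 2))%R by field.
        exact (Cmod_ball _ _ _ (Hn (S n) (le_S _ _ (le_n n)))). }
  assert (Hin : forall n, (Cmod (u n - x) < d / 2)%R).
  { intros n. destruct (Hu n) as [H _].
    assert (Hp : (0 < (1 / 2) ^ n)%R) by (apply pow_lt; lra). nra. }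
  assert (Hsx : (Cmod (s - x) < d)%R).
  { destruct (Hs (d / 2)%R ltac:(lra)) as (n & Hn & _).
    pose proof (Cmod_triangle_minus s (u n) x) as Ht. rewrite (Cmod_minus_sym s (u n)) in Ht.
    specialize (Hin n). lra. }
  exists s. split; [exact Hsx|].
  destruct (Req_dec (Cmod (N s - s)) 0) as [H0|H0].
  - apply Cmod_eq_0 in H0. replace (N s) with (N s - s + s) by ring. rewrite H0. ring.
  - pose proof (Cmod_ge_0 (N s - s)).
    destruct (Hs (Cmod (N s - s) / 2)%R ltac:(lra)) as (n & H1 & H2).
    pose proof (Cmod_triangle_minus (N s) (N (u n)) s) as Ht.
    specialize (Hin n).
    pose proof (HN s (u n) Hsx ltac:(lra)) as H3.
    rewrite (Cmod_minus_sym s) in H3. change (N (u n)) with (u (S n)) in *. lra.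
Qed.

(** The inverse function theorem.  On a small disc [f] is [l] times the identity up to an
    error of Lipschitz constant [|l| / 2].  So [f] is injective there with a Lipschitz inverse,
    and [f s = u] is the fixed point equation of the half-contraction
    [a -> a - (f a - u) / l].  Continuity of [G] at every [u] near [f x], not just at [f x],
    is what allows it to be differentiated on a neighbourhood. *)
Lemma local_inverse (f : C -> C) (x l : C) :
  strictly_diff f x l -> l <> 0 ->
  exists G : C -> C,
    locally x (fun s => G (f s) = s) /\
    locally (f x) (fun u => f (G u) = u /\ continuous G u).
Proof.
  intros (phi & Hf & Cf & <-) Hl. set (l := phi (x, x)) in *.
  assert (Hm : (0 < Cmod l)%R) by (apply Cmod_gt_0, Hl).
  assert (Hb : locally (x, x) (fun ab => (Cmod (phi ab - l) < Cmod l / 2)%R)).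
  { apply (Cf (fun z : C => (Cmod (z - l) < Cmod l / 2)%R)). apply locally_Cmod.
    exists (Cmod l / 2)%R. split; [lra | auto]. }
  destruct (locally_pair_Cmod _ _ _ (filter_and _ _ Hf Hb)) as (d & Hd & H).
  assert (Hs : forall a b, (Cmod (a - x) < d)%R -> (Cmod (b - x) < d)%R ->
    (Cmod (f a - f b - l * (a - b)) <= Cmod l / 2 * Cmod (a - b))%R).
  { intros a b Ha Hb'. destruct (H a b Ha Hb') as [H1 H2]. simpl in H1. rewrite H1.
    replace (phi (a, b) * (a - b) - l * (a - b)) with ((phi (a, b) - l) * (a - b)) by ring.
    rewrite Cmod_mult. apply Rmult_le_compat_r; [apply Cmod_ge_0 | lra]. }
  assert (Hinj : forall a b, (Cmod (a - x) < d)%R -> (Cmod (b - x) < d)%R ->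
    (Cmod l / 2 * Cmod (a - b) <= Cmod (f a - f b))%R).
  { intros a b Ha Hb'. specialize (Hs a b Ha Hb').
    pose proof (Cmod_triangle_minus (l * (a - b)) (f a - f b) 0) as Ht.
    replace (l * (a - b) - 0) with (l * (a - b)) in Ht by ring.
    replace (f a - f b - 0) with (f a - f b) in Ht by ring.
    rewrite Cmod_minus_sym, Cmod_mult in Ht. lra. }
  pose (G := fun u => epsilon (inhabits (RtoC 0)) (fun s => (Cmod (s - x) < d)%R /\ f s = u)).
  assert (HG : forall s, (Cmod (s - x) < d)%R ->
    (Cmod (G (f s) - x) < d)%R /\ f (G (f s)) = f s).
  { intros s Hsd. apply (epsilon_spec (inhabits (RtoC 0))
      (fun s' => (Cmod (s' - x) < d)%R /\ f s' = f s)). exists s. auto. }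
  assert (Hsurj : forall u, (Cmod (u - f x) < Cmod l * d / 4)%R ->
    exists s, (Cmod (s - x) < d)%R /\ f s = u).
  { intros u Hu.
    destruct (half_contraction_fixed_point (fun a => a - (f a - u) / l) x d Hd) as (s & Hsd & Hfix).
    - intros a b Ha Hb'.
      replace (a - (f a - u) / l - (b - (f b - u) / l))
        with (- ((f a - f b - l * (a - b)) / l)) by (field; exact Hl).
      rewrite Cmod_opp, Cmod_div by exact Hl. apply Rle_div_l; [exact Hm|].
      specialize (Hs a b Ha Hb'). lra.
    - replace (x - (f x - u) / l - x) with ((u - f x) / l) by (field; exact Hl).
      rewrite Cmod_div by exact Hl. apply Rlt_div_l; [exact Hm | lra].
    - exists s. split; [exact Hsd|].
      replace (f s) with (u + (s - (s - (f s - u) / l)) * l) by (field; exact Hl).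
      rewrite Hfix. ring. }
  exists G. split.
  - apply locally_Cmod. exists d. split; [exact Hd|]. intros s Hsd.
    destruct (HG s Hsd) as [H1 H2].
    pose proof (Hinj _ _ H1 Hsd) as H3. rewrite H2 in H3.
    replace (f s - f s) with (RtoC 0) in H3 by ring. rewrite Cmod_0 in H3.
    pose proof (Cmod_ge_0 (G (f s) - s)).
    assert (H4 : Cmod (G (f s) - s) = 0%R) by nra.
    apply Cmod_eq_0 in H4. replace (G (f s)) with (G (f s) - s + s) by ring. rewrite H4. ring.
  - assert (HGu : forall u, (Cmod (u - f x) < Cmod l * d / 4)%R ->
      (Cmod (G u - x) < d)%R /\ f (G u) = u).
    { intros u Hu. destruct (Hsurj u Hu) as (s & Hsd & <-). apply HG, Hsd. }
    apply locally_Cmod. exists (Cmod l * d / 4)%R. split; [nra|].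
    intros u Hu. split; [apply HGu, Hu|].
    intros P HP. apply locally_Cmod in HP. destruct HP as (e & He & HP).
    unfold filtermap. apply locally_Cmod.
    exists (Rmin (Cmod l * d / 4 - Cmod (u - f x)) (Cmod l / 2 * e)). split.
    { apply Rmin_glb_lt; nra. }
    intros v Hv. apply HP.
    pose proof (Rmin_l (Cmod l * d / 4 - Cmod (u - f x)) (Cmod l / 2 * e)).
    pose proof (Rmin_r (Cmod l * d / 4 - Cmod (u - f x)) (Cmod l / 2 * e)).
    pose proof (Cmod_triangle_minus v u (f x)).
    destruct (HGu u Hu) as [U1 U2]. destruct (HGu v ltac:(lra)) as [V1 V2].
    pose proof (Hinj _ _ V1 U1) as Huv. rewrite U2, V2 in Huv. nra.
Qed.

(** The difference quotient of [G] is the inverse of that of [f]. *)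
Lemma strictly_diff_inverse (f G : C -> C) (u l : C) :
  continuous G u -> locally u (fun v => f (G v) = v) ->
  strictly_diff f (G u) l -> l <> 0 -> strictly_diff G u (/ l).
Proof.
  intros KG HG (phi & Hf & Cf & <-) Hl.
  assert (KGG : continuous (fun ab : C * C => (G (fst ab), G (snd ab))) (u, u)).
  { apply continuous_map_pair; assumption. }
  assert (Kphi : continuous (fun ab : C * C => phi (G (fst ab), G (snd ab))) (u, u)).
  { apply (continuous_comp (fun ab : C * C => (G (fst ab), G (snd ab))) phi); assumption. }
  assert (H1 : locally (u, u) (fun ab : C * C => f (G (fst ab)) = fst ab)).
  { exact (continuous_fst (U := C_UniformSpace) (V := C_UniformSpace) u u _ HG). }
  assert (H2 : locally (u, u) (fun ab : C * C => f (G (snd ab)) = snd ab)).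
  { exact (continuous_snd (U := C_UniformSpace) (V := C_UniformSpace) u u _ HG). }
  exists (fun ab => / phi (G (fst ab), G (snd ab))).
  split; [|split; [apply continuous_Cinv_comp; assumption | reflexivity]].
  pose proof (locally_neq0 _ _ Kphi Hl) as H3.
  assert (H4 : locally (u, u) (fun ab : C * C => f (G (fst ab)) - f (G (snd ab)) =
    phi (G (fst ab), G (snd ab)) * (G (fst ab) - G (snd ab)))) by exact (KGG _ Hf).
  generalize (filter_and _ _ (filter_and _ _ H1 H2) (filter_and _ _ H4 H3)).
  apply filter_imp. intros [a b] [[E1 E2] [E3 E4]]; simpl in *.
  rewrite E1, E2 in E3. rewrite E3. field. exact E4.
Qed.

Ltac differentiate := lazymatch goal with
  | |- strictly_diff (fun s => @?f s + @?g s) _ _ => apply (strictly_diff_plus f g); differentiate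
  | |- strictly_diff (fun s => @?f s - @?g s) _ _ => apply (strictly_diff_minus f g); differentiate
  | |- strictly_diff (fun s => - @?f s) _ _ => apply (strictly_diff_opp f); differentiate
  | |- strictly_diff (fun s => @?f s * @?g s) _ _ => apply (strictly_diff_mult f g); differentiate
  | |- strictly_diff (fun s => @?f s / @?g s) _ _ =>
      apply (strictly_diff_div f g); [differentiate | differentiate |]
  | |- strictly_diff (fun s => @?f s ^ ?n) _ _ => apply (strictly_diff_pow f); differentiate
  | |- strictly_diff (fun s => s) _ _ => apply strictly_diff_id
  | |- strictly_diff (fun s => _) _ _ => apply strictly_diff_const
  end.

(** * Polynomials as coefficient lists *)

Fixpoint peval (p : list C) (s : C) : C :=
  match p with [] => 0 | c :: p => c + s * peval p s end.
Fixpoint padd (p q : list C) : list C :=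
  match p, q with
  | [], _ => q
  | _, [] => p
  | a :: p, b :: q => (a + b) :: padd p q
  end.
Definition pscale (c : C) (p : list C) : list C := map (fun a => c * a) p.
(** Coefficient lists carry no normal form: only an upper bound for the degree is ever needed,
    and the length provides it. *)
Fixpoint pmul (p q : list C) : list C :=
  match p with [] => [] | a :: p => padd (pscale a q) (RtoC 0 :: pmul p q) end.

Lemma peval_add p q s : peval (padd p q) s = peval p s + peval q s.
Proof.
  revert q. induction p as [|a p IH]; intros [|b q]; simpl; try ring.
  rewrite IH. ring.
Qed.

Lemma peval_scale c p s : peval (pscale c p) s = c * peval p s.
Proof. induction p as [|a p IH]; simpl; [ring|]. fold (pscale c p). rewrite IH. ring. Qed.

Lemma peval_mul p q s : peval (pmul p q) s = peval p s * peval q s.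
Proof.
  induction p as [|a p IH]; simpl; [ring|].
  rewrite peval_add, peval_scale. simpl. rewrite IH. ring.
Qed.

Lemma length_padd p q : length (padd p q) = Nat.max (length p) (length q).
Proof. revert q. induction p as [|a p IH]; intros [|b q]; simpl; auto. Qed.

Lemma length_pmul p q : (length (pmul p q) <= length p + length q)%nat.
Proof.
  induction p as [|a p IH]; simpl; [lia|].
  rewrite length_padd. unfold pscale. rewrite length_map. simpl. lia.
Qed.

Definition is_poly (f : C -> C) : Prop := exists p, forall s, f s = peval p s.

Lemma is_poly_const c : is_poly (fun _ => c).
Proof. exists [c]. intros s. simpl. ring. Qed.

Lemma is_poly_id : is_poly (fun s => s).
Proof. exists [RtoC 0; RtoC 1]. intros s. simpl. ring. Qed.

Lemma is_poly_plus f g : is_poly f -> is_poly g -> is_poly (fun s => f s + g s).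
Proof.
  intros [p Hp] [q Hq]. exists (padd p q). intros s. rewrite peval_add, Hp, Hq. reflexivity.
Qed.

Lemma is_poly_mult f g : is_poly f -> is_poly g -> is_poly (fun s => f s * g s).
Proof.
  intros [p Hp] [q Hq]. exists (pmul p q). intros s. rewrite peval_mul, Hp, Hq. reflexivity.
Qed.

Lemma is_poly_opp f : is_poly f -> is_poly (fun s => - f s).
Proof.
  intros [p Hp]. exists (pscale (- (1)) p). intros s. rewrite peval_scale, Hp. ring.
Qed.

Lemma is_poly_pow f n : is_poly f -> is_poly (fun s => f s ^ n).
Proof.
  intros Hf. induction n as [|n IH]; simpl.
  - apply is_poly_const.
  - apply is_poly_mult; assumption.
Qed.

(** The quotient of [p - p(a)] by the linear polynomial with root [a] (Horner scheme). *)
Fixpoint quotient_by_root (a : C) (p : list C) : list C :=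
  match p with [] => [] | _ :: p => padd p (pscale a (quotient_by_root a p)) end.

Lemma peval_quotient a p s :
  peval p s = peval p a + (s - a) * peval (quotient_by_root a p) s.
Proof.
  induction p as [|c p IH]; simpl; [ring|].
  rewrite peval_add, peval_scale, IH. ring.
Qed.

Lemma length_quotient a p : (length (quotient_by_root a p) <= pred (length p))%nat.
Proof.
  induction p as [|c p IH]; simpl; [lia|].
  rewrite length_padd. unfold pscale. rewrite length_map. lia.
Qed.

(** Each root splits off a linear factor, which lowers the length of the coefficient list. *)
Lemma finitely_many_roots f :
  is_poly f -> (exists x, f x <> 0) -> exists E, forall s, f s = 0 -> In s E.
Proof.
  intros [p Hp] [x Hx]. rewrite Hp in Hx.
  cut (exists E, forall s, peval p s = 0 -> In s E).
  { intros [E HE]. exists E. intros s Hs. apply HE. rewrite <- Hp. exact Hs. }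
  clear f Hp. remember (length p) as n eqn:Hn.
  assert (Hle : (length p <= n)%nat) by lia. clear Hn.
  revert p Hle Hx. induction n as [|n IH]; intros p Hle Hx.
  - destruct p; [|simpl in Hle; lia]. simpl in Hx. congruence.
  - destruct (excluded_middle_informative (exists a, peval p a = 0)) as [[a Ha]|Hno].
    + destruct (IH (quotient_by_root a p)) as [E HE].
      * pose proof (length_quotient a p). lia.
      * intros H0. apply Hx. rewrite (peval_quotient a p x), Ha, H0. ring.
      * exists (a :: E). intros s Hs. simpl.
        destruct (excluded_middle_informative (a = s)) as [Has|Has]; [left; exact Has | right].
        apply HE. rewrite (peval_quotient a p s), Ha in Hs.
        destruct (excluded_middle_informative (peval (quotient_by_root a p) s = 0))
          as [H0|H0]; [exact H0 | exfalso].
        apply (Cmult_neq_0 (s - a) (peval (quotient_by_root a p) s)); [|exact H0|].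
        -- intros H1. apply Has. replace s with (s - a + a) by ring. rewrite H1. ring.
        -- rewrite <- Hs. ring.
    + exists []. intros s Hs. exfalso. apply Hno. exists s. exact Hs.
Qed.

Lemma is_poly_continuous (f : C -> C) (x : C) : is_poly f -> continuous f x.
Proof.
  intros [p Hp]. apply continuous_ext with (peval p); [intros s; symmetry; apply Hp|].
  clear Hp. induction p as [|c p IH]; simpl; [apply continuous_const|].
  apply continuous_Cplus; [apply continuous_const|].
  apply continuous_Cmult; [apply continuous_id | exact IH].
Qed.

Ltac polynomial := unfold Cminus; repeat first
  [ apply is_poly_plus | apply is_poly_opp | apply is_poly_mult | apply is_poly_pow
  | apply is_poly_const | apply is_poly_id ].

(** * Linear and algebraic dependence *)

Definition lsum {I : Type} (f : I -> C) (l : list I) : C :=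
  fold_right (fun i v => f i + v) (RtoC 0) l.

Lemma lsum_app {I} (f : I -> C) l l' : lsum f (l ++ l') = lsum f l + lsum f l'.
Proof. induction l as [|i l IH]; simpl; [ring|]. rewrite IH. ring. Qed.

Lemma lsum_ext {I} (f g : I -> C) l :
  (forall i, In i l -> f i = g i) -> lsum f l = lsum g l.
Proof.
  intros H. induction l as [|i l IH]; simpl; [reflexivity|].
  rewrite H, IH; auto with datatypes.
Qed.

Lemma lsum_0 {I} (l : list I) : lsum (fun _ => RtoC 0) l = 0.
Proof. induction l as [|i l IH]; simpl; [reflexivity|]. rewrite IH. ring. Qed.

Lemma lsum_plus {I} (f g : I -> C) l : lsum (fun i => f i + g i) l = lsum f l + lsum g l.
Proof. induction l as [|i l IH]; simpl; [ring|]. rewrite IH. ring. Qed.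

Lemma lsum_scale {I} c (f : I -> C) l : lsum (fun i => c * f i) l = c * lsum f l.
Proof. induction l as [|i l IH]; simpl; [ring|]. rewrite IH. ring. Qed.

Lemma lsum_exchange {I J} (f : I -> J -> C) l l' :
  lsum (fun i => lsum (f i) l') l = lsum (fun j => lsum (fun i => f i j) l) l'.
Proof.
  induction l as [|i l IH]; simpl; [rewrite lsum_0; reflexivity|].
  rewrite lsum_plus, IH. reflexivity.
Qed.

Lemma lsum_list_prod {I J} (f : I * J -> C) l l' :
  lsum f (list_prod l l') = lsum (fun i => lsum (fun j => f (i, j)) l') l.
Proof.
  induction l as [|i l IH]; simpl; [reflexivity|].
  rewrite lsum_app, IH. f_equal.
  clear. induction l' as [|j l' IH]; simpl; [reflexivity|]. rewrite IH. reflexivity.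
Qed.

Lemma NoDup_list_prod {I J} (l : list I) (l' : list J) :
  NoDup l -> NoDup l' -> NoDup (list_prod l l').
Proof.
  intros Hl Hl'. induction Hl as [|i l Hi Hl IH]; simpl; [constructor|].
  apply NoDup_app; [|exact IH|].
  - apply Injective_map_NoDup; [|exact Hl']. intros j j' H. congruence.
  - intros [i' j] H1 H2. apply in_map_iff in H1. destruct H1 as (j' & H1 & _).
    apply in_prod_iff in H2. apply Hi. injection H1 as <- _. apply H2.
Qed.

Lemma sum_n_lsum (f : nat -> C) N : sum_n f N = lsum f (seq 0 (S N)).
Proof.
  induction N as [|N IH].
  - rewrite sum_O. simpl. ring.
  - rewrite sum_Sn, IH, (seq_S (S N)), lsum_app. simpl.
    change plus with Cplus. ring.
Qed.

Lemma peval_lsum p s M :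
  (length p <= M)%nat -> peval p s = lsum (fun k => nth k p 0 * s ^ k) (seq 0 M).
Proof.
  revert p. induction M as [|M IH]; intros p Hp.
  - destruct p; [reflexivity | simpl in Hp; lia].
  - rewrite <- cons_seq, <- seq_shift. destruct p as [|c p].
    + simpl. rewrite (lsum_ext _ (fun _ => RtoC 0)), lsum_0; [ring|].
      intros k _. destruct k; ring.
    + simpl. rewrite (IH p) by (simpl in Hp; lia). rewrite <- lsum_scale.
      f_equal; [ring|].
      clear. induction (seq 0 M) as [|k l IHl]; simpl; [reflexivity|].
      rewrite IHl. f_equal. ring.
Qed.

(** More than [m] vectors with [m] coordinates are linearly dependent: a vector with a nonzero
    last coordinate serves as pivot to eliminate that coordinate from the others. *)
Lemma linear_dependence {I : Type} (m : nat) : forall (l : list I) (A : I -> nat -> C),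
  NoDup l -> (m < length l)%nat ->
  exists x : I -> C, (exists i, In i l /\ x i <> 0) /\
    forall k, (k < m)%nat -> lsum (fun i => x i * A i k) l = 0.
Proof.
  induction m as [|m IH]; intros l A Hl Hm.
  - destruct l as [|i l]; [simpl in Hm; lia|].
    exists (fun _ => RtoC 1). split; [|intros k Hk; lia].
    exists i. split; [left; reflexivity | exact C1_nz].
  - destruct (excluded_middle_informative (exists i, In i l /\ A i m <> 0))
      as [(i0 & Hi0 & HA)|Hno].
    + destruct (in_split _ _ Hi0) as (l1 & l2 & ->).
      destruct (NoDup_remove _ _ _ Hl) as [Hl' Hnot].
      destruct (IH (l1 ++ l2) (fun i k => A i k - A i m / A i0 m * A i0 k) Hl')
        as (x' & (i1 & Hi1 & Hx1) & Hx').
      { rewrite length_app in *. simpl in Hm. lia. }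
      pose (c := - lsum (fun i => x' i * A i m) (l1 ++ l2) / A i0 m).
      pose (x := fun i => if excluded_middle_informative (i = i0) then c else x' i).
      assert (Hx0 : x i0 = c).
      { unfold x. destruct (excluded_middle_informative (i0 = i0)); congruence. }
      assert (Hx : forall i, In i (l1 ++ l2) -> x i = x' i).
      { intros i Hi. unfold x.
        destruct (excluded_middle_informative (i = i0)); [subst; contradiction | reflexivity]. }
      assert (Hsum : forall k, lsum (fun i => x i * A i k) (l1 ++ i0 :: l2) =
        c * A i0 k + lsum (fun i => x' i * A i k) (l1 ++ l2)).
      { intros k. rewrite <- (lsum_ext (fun i => x i * A i k) (fun i => x' i * A i k))
          by (intros i Hi; rewrite Hx by exact Hi; reflexivity).
        rewrite !lsum_app. simpl. rewrite Hx0. ring. }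
      exists x. split.
      * exists i1. rewrite Hx by exact Hi1. split; [|exact Hx1].
        apply in_app_iff in Hi1. apply in_app_iff. simpl. tauto.
      * intros k Hk. rewrite Hsum.
        destruct (Nat.eq_dec k m) as [->|Hkm]; [unfold c; field; exact HA|].
        specialize (Hx' k ltac:(lia)).
        rewrite (lsum_ext _ (fun i => x' i * A i k + (- A i0 k / A i0 m) * (x' i * A i m)))
          in Hx' by (intros i _; field; exact HA).
        rewrite lsum_plus, lsum_scale in Hx'. rewrite <- Hx'. unfold c. field. exact HA.
    + destruct (IH l A Hl ltac:(lia)) as (x & Hx & H).
      exists x. split; [exact Hx|]. intros k Hk.
      destruct (Nat.eq_dec k m) as [->|Hkm]; [|apply H; lia].
      rewrite (lsum_ext _ (fun _ => RtoC 0)); [apply lsum_0|].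
      intros i Hi. destruct (excluded_middle_informative (A i m = 0)) as [->|H0]; [ring|].
      exfalso. eauto.
Qed.

(** The function [F], multiplied by the power [2 * n] of the denominator [d], becomes
    [P(s) + tau * Q(s)] with degrees at most [n * k].  Each factor [T] or [y] costs two powers
    of [d]: one clears its own denominator, one that of the [tau ^ 2] which the product
    creates. *)
Definition quadratic_form {X : Type} (k : nat) (s tau : X -> C) (d : list C) (n : nat)
    (F : X -> C) : Prop :=
  exists P Q : list C, (length P <= n * k + 1)%nat /\ (length Q <= n * k + 1)%nat /\
    forall x, peval d (s x) ^ (2 * n) * F x = peval P (s x) + tau x * peval Q (s x).

Lemma quadratic_form_mult {X : Type} (k : nat) (s tau : X -> C) (d e a b : list C)
    (U F : X -> C) (n : nat) :
  (forall x, peval d (s x) * tau x ^ 2 = peval e (s x)) ->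
  (forall x, peval d (s x) * U x = peval a (s x) + tau x * peval b (s x)) ->
  (length d + length e + length a + length b <= k)%nat ->
  quadratic_form k s tau d n F -> quadratic_form k s tau d (S n) (fun x => U x * F x).
Proof.
  intros He HU Hk (P & Q & HP & HQ & HF).
  exists (padd (pmul (pmul d a) P) (pmul (pmul e b) Q)).
  exists (padd (pmul (pmul d b) P) (pmul (pmul d a) Q)).
  pose proof (length_pmul d a). pose proof (length_pmul d b). pose proof (length_pmul e b).
  pose proof (length_pmul (pmul d a) P). pose proof (length_pmul (pmul d a) Q).
  pose proof (length_pmul (pmul d b) P). pose proof (length_pmul (pmul e b) Q).
  rewrite !length_padd. split; [simpl; lia | split; [simpl; lia|]].
  intros x. rewrite !peval_add, !peval_mul, <- (He x).
  replace (2 * S n)%nat with (S (S (2 * n))) by lia. rewrite !Cpow_S.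
  transitivity (peval d (s x) * (peval d (s x) * U x) * (peval d (s x) ^ (2 * n) * F x));
    [ring|]. rewrite HU, HF. ring.
Qed.

(** The [(N + 1) ^ 2] monomials [T ^ i * y ^ j] are represented by pairs of polynomials with
    [2 * (2 * N * k + 1)] coefficients in all; [N = 4 * k + 2] makes the monomials more
    numerous. *)
Lemma algebraic_dependence {X : Type} (s tau T y : X -> C) (d e a b a' b' : C -> C) :
  is_poly d -> is_poly e -> is_poly a -> is_poly b -> is_poly a' -> is_poly b' ->
  (forall x, d (s x) <> 0) ->
  (forall x, d (s x) * tau x ^ 2 = e (s x)) ->
  (forall x, d (s x) * T x = a (s x) + tau x * b (s x)) ->
  (forall x, d (s x) * y x = a' (s x) + tau x * b' (s x)) ->
  exists (N : nat) (c : nat -> nat -> C),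
    (exists i j : nat, (i <= N)%nat /\ (j <= N)%nat /\ c i j <> 0) /\
    forall x, sum_n (fun i => sum_n (fun j => c i j * T x ^ i * y x ^ j) N) N = RtoC 0.
Proof.
  intros [pd Hd] [pe He] [pa Ha] [pb Hb] [pa' Ha'] [pb' Hb'] Hnz Htau HT Hy.
  pose (k := (length pd + length pd + length pe + length pa + length pb
              + length pa' + length pb')%nat).
  pose (QF := quadratic_form k s tau pd).
  assert (Htau' : forall x, peval pd (s x) * tau x ^ 2 = peval pe (s x))
    by (intros x; rewrite <- Hd, <- He; apply Htau).
  assert (H1 : QF 0%nat (fun _ => RtoC 1)).
  { exists [RtoC 1], []. simpl. split; [lia | split; [lia|]]. intros x. ring. }
  assert (HT' : forall n F, QF n F -> QF (S n) (fun x => T x * F x)).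
  { intros n F. apply quadratic_form_mult with pe pa pb; [exact Htau' | | unfold k; lia].
    intros x. rewrite <- Hd, <- Ha, <- Hb. apply HT. }
  assert (Hy' : forall n F, QF n F -> QF (S n) (fun x => y x * F x)).
  { intros n F. apply quadratic_form_mult with pe pa' pb'; [exact Htau' | | unfold k; lia].
    intros x. rewrite <- Hd, <- Ha', <- Hb'. apply Hy. }
  assert (Hraise : forall n m F, QF n F -> QF (m + n)%nat F).
  { intros n m F HF. induction m as [|m IH]; [exact HF|].
    destruct (quadratic_form_mult k s tau pd pe pd [] (fun _ => RtoC 1) F (m + n) Htau')
      as (P & Q & HP & HQ & HPQ).
    - intros x. simpl. ring.
    - simpl. unfold k. lia.
    - exact IH.
    - exists P, Q. split; [exact HP | split; [exact HQ|]].
      intros x. rewrite <- HPQ. simpl. ring. }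
  assert (Hmon : forall i j, QF (i + j)%nat (fun x => T x ^ i * y x ^ j)).
  { intros i j. assert (HQ : QF j (fun x => y x ^ j)).
    { induction j as [|j IH]; simpl; [exact H1 | apply Hy', IH]. }
    induction i as [|i IH]; simpl.
    - destruct HQ as (P & Q & HP & HQ & H). exists P, Q.
      split; [exact HP | split; [exact HQ|]]. intros x. rewrite <- H. simpl. ring.
    - destruct (HT' _ _ IH) as (P & Q & HP & HQ' & H). exists P, Q.
      split; [exact HP | split; [exact HQ'|]]. intros x. rewrite <- H. simpl. ring. }
  (* All monomials are brought to the same power [2 * (2 * N)] of the denominator. *)
  pose (N := (4 * k + 2)%nat). pose (M := (2 * N * k + 1)%nat).
  assert (Hrep : forall ij : nat * nat, exists PQ : list C * list C,
    (fst ij <= N)%nat -> (snd ij <= N)%nat ->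
    (length (fst PQ) <= M)%nat /\ (length (snd PQ) <= M)%nat /\
    forall x, peval pd (s x) ^ (2 * (2 * N)) * (T x ^ fst ij * y x ^ snd ij) =
      peval (fst PQ) (s x) + tau x * peval (snd PQ) (s x)).
  { intros [i j]; simpl fst; simpl snd.
    destruct (excluded_middle_informative (i <= N /\ j <= N)%nat) as [[Hi Hj]|Hij].
    - destruct (Hraise _ (2 * N - (i + j))%nat _ (Hmon i j)) as (P & Q & HP & HQ & H).
      replace (2 * N - (i + j) + (i + j))%nat with (2 * N)%nat in * by lia.
      exists (P, Q). intros _ _. split; [exact HP | split; [exact HQ | exact H]].
    - exists ([], []). intros; exfalso; tauto. }
  pose (PQ := fun ij => proj1_sig (constructive_indefinite_description _ (Hrep ij))).
  assert (HPQ : forall i j, (i <= N)%nat -> (j <= N)%nat ->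
    (length (fst (PQ (i, j))) <= M)%nat /\ (length (snd (PQ (i, j))) <= M)%nat /\
    forall x, peval pd (s x) ^ (2 * (2 * N)) * (T x ^ i * y x ^ j) =
      peval (fst (PQ (i, j))) (s x) + tau x * peval (snd (PQ (i, j))) (s x)).
  { intros i j Hi Hj. unfold PQ.
    destruct (constructive_indefinite_description _ (Hrep (i, j))) as [pq H]; simpl.
    apply H; assumption. }
  clearbody PQ.
  pose (l := list_prod (seq 0 (S N)) (seq 0 (S N))).
  assert (Hl : forall i j, In (i, j) l <-> (i <= N)%nat /\ (j <= N)%nat).
  { intros i j. unfold l. rewrite in_prod_iff, !in_seq. lia. }
  (* The coordinates of a monomial: first the coefficients of [P], then those of [Q]. *)
  destruct (linear_dependence (2 * M) l
    (fun ij n => if (n <? M)%nat then nth n (fst (PQ ij)) 0 else nth (n - M) (snd (PQ ij)) 0))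
    as (c & ([i0 j0] & Hij & Hc) & Hker).
  { apply NoDup_list_prod; apply seq_NoDup. }
  { unfold l. rewrite length_prod, length_seq. unfold M, N. nia. }
  assert (Hker1 : forall n, (n < M)%nat -> lsum (fun ij => c ij * nth n (fst (PQ ij)) 0) l = 0).
  { intros n Hn. eapply eq_trans; [apply lsum_ext | apply (Hker n); lia]. intros ij _.
    destruct (Nat.ltb_spec n M); [reflexivity | lia]. }
  assert (Hker2 : forall n, (n < M)%nat -> lsum (fun ij => c ij * nth n (snd (PQ ij)) 0) l = 0).
  { intros n Hn. eapply eq_trans; [apply lsum_ext | apply (Hker (M + n)%nat); lia]. intros ij _.
    destruct (Nat.ltb_spec (M + n) M); [lia|]. do 2 f_equal. lia. }
  assert (Hkill : forall (p : nat * nat -> list C) z,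
    (forall i j, (i <= N)%nat -> (j <= N)%nat -> (length (p (i, j)) <= M)%nat) ->
    (forall n, (n < M)%nat -> lsum (fun ij => c ij * nth n (p ij) 0) l = 0) ->
    lsum (fun ij => c ij * peval (p ij) z) l = 0).
  { intros p z Hp Hz.
    rewrite (lsum_ext _ (fun ij => lsum (fun n => c ij * nth n (p ij) 0 * z ^ n) (seq 0 M))).
    - rewrite lsum_exchange, (lsum_ext _ (fun _ => RtoC 0)); [apply lsum_0|].
      intros n Hn. apply in_seq in Hn.
      rewrite (lsum_ext _ (fun ij => z ^ n * (c ij * nth n (p ij) 0))) by (intros; ring).
      rewrite lsum_scale, Hz by lia. ring.
    - intros [i j] Hij'. apply Hl in Hij'.
      rewrite (peval_lsum _ _ M) by (apply Hp; tauto).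
      rewrite <- lsum_scale. apply lsum_ext. intros; ring. }
  exists N, (fun i j => c (i, j)). split.
  { exists i0, j0. apply Hl in Hij. tauto. }
  intros x.
  assert (Hsum : lsum (fun ij => c ij * (T x ^ fst ij * y x ^ snd ij)) l = 0).
  { set (D := peval pd (s x) ^ (2 * (2 * N))).
    assert (HD : D <> 0) by (apply Cpow_nz; rewrite <- Hd; apply Hnz).
    transitivity (/ D * lsum (fun ij => c ij * (D * (T x ^ fst ij * y x ^ snd ij))) l).
    { rewrite <- lsum_scale. apply lsum_ext. intros; field; exact HD. }
    rewrite (lsum_ext _ (fun ij => c ij * peval (fst (PQ ij)) (s x) +
      tau x * (c ij * peval (snd (PQ ij)) (s x)))).
    - rewrite lsum_plus, lsum_scale, !Hkill; try assumption; [ring | |];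
        intros i j Hi Hj; apply (HPQ i j Hi Hj).
    - intros [i j] Hij'. apply Hl in Hij'. simpl fst; simpl snd. unfold D.
      rewrite (proj2 (proj2 (HPQ i j (proj1 Hij') (proj2 Hij')))). ring. }
  eapply eq_trans; [|exact Hsum]. unfold l. rewrite lsum_list_prod, sum_n_lsum. apply lsum_ext.
  intros i _. rewrite sum_n_lsum. apply lsum_ext. intros j _. simpl. ring.
Qed.

(** * The Painleve equation in centred coordinates *)

Lemma RtoC_neq0 (r : R) : (r <> 0)%R -> RtoC r <> 0.
Proof. intros Hr H. apply Hr, RtoC_inj, H. Qed.

Lemma Cdiv_neq0 (a b : C) : a <> 0 -> b <> 0 -> a / b <> 0.
Proof.
  intros Ha Hb H. apply Ha. replace a with (a / b * b) by (field; exact Hb). rewrite H. ring.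
Qed.

Lemma Copp_neq0 (a : C) : a <> 0 -> - a <> 0.
Proof. intros Ha H. apply Ha. replace a with (- - a) by ring. rewrite H. ring. Qed.

Lemma neq0_factor_l (a b c : C) : a <> 0 -> a = b * c -> b <> 0.
Proof. intros Ha E H. apply Ha. rewrite E, H. ring. Qed.

Lemma neq0_factor_r (a b c : C) : a <> 0 -> a = b * c -> c <> 0.
Proof. intros Ha E H. apply Ha. rewrite E, H. ring. Qed.

Ltac nonzero := repeat match goal with
  | |- _ /\ _ => split
  | |- Cmult _ _ <> _ => apply Cmult_neq_0
  | |- Cdiv _ _ <> _ => apply Cdiv_neq0
  | |- Copp _ <> _ => apply Copp_neq0
  | |- Cpow _ _ <> _ => apply Cpow_nz
  | |- RtoC _ <> _ => apply RtoC_neq0, eq_IZR_contrapositive; discriminate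
  end; try assumption.

(** With [T = 1/2 + tau] and [y = 1/2 + tau * rho], the equation multiplied by [tau] contains
    only [tau ^ 2].  For instance [1/y + 1/(y - 1) = 2 * tau * rho / Yq], where
    [Yq = y * (y - 1)] and [Tq = T * (T - 1)], and the terms with [beta = - 1/18] and
    [gamma = 1/18] add up to
    [1/18 * (2 * tau ^ 2 * rho - 1/4 - tau ^ 2 * rho ^ 2) / Yq ^ 2]. *)
Lemma PVI_symmetric (tau rho r y2 : C) :
  let g := tau ^ 2 in
  let Tq := g - 1 / 4 in
  let Yq := g * rho ^ 2 - 1 / 4 in
  tau <> 0 -> rho <> 1 -> Tq <> 0 -> Yq <> 0 ->
  tau * y2 =
    1 / 2 * (2 * g * rho / Yq + 1 / (rho - 1)) * r ^ 2 - (2 * g / Tq + 1 / (rho - 1)) * r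
    + Yq * g * (rho - 1) / Tq ^ 2
      * (8 / 25 + 1 / 18 * (2 * g * rho - 1 / 4 - g * rho ^ 2) / Yq ^ 2
         + 4 / 9 * Tq / (g * (rho - 1) ^ 2)) ->
  PVI (1 / 3) (1 / 3) (1 / 3) (1 / 5) (1 / 2 + tau) (1 / 2 + tau * rho) r y2.
Proof.
  intros g Tq Yq Ht Hr HT HY E.
  (* Twice [T], [T - 1], [y], [y - 1] and [y - T], in the form in which [field] will ask for
     them. *)
  assert (HT1 : 1 + tau * 2 <> 0)
    by (apply (neq0_factor_l Tq _ ((tau * 2 - 1) / 4) HT); unfold Tq, g; field).
  assert (HT2 : 1 + tau * 2 - 2 <> 0)
    by (apply (neq0_factor_l Tq _ ((1 + tau * 2) / 4) HT); unfold Tq, g; field).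
  assert (HY1 : 1 + tau * rho * 2 <> 0)
    by (apply (neq0_factor_l Yq _ ((tau * rho * 2 - 1) / 4) HY); unfold Yq, g; field).
  assert (HY2 : 1 + tau * rho * 2 - 2 <> 0)
    by (apply (neq0_factor_l Yq _ ((1 + tau * rho * 2) / 4) HY); unfold Yq, g; field).
  assert (Hr1 : rho - 1 <> 0).
  { intros H. apply Hr. replace rho with (rho - 1 + 1) by ring. rewrite H. ring. }
  assert (Hyt : 1 + tau * rho * 2 - (1 + tau * 2) <> 0).
  { intros H. apply (Cmult_neq_0 tau (rho - 1) Ht Hr1).
    transitivity ((1 + tau * rho * 2 - (1 + tau * 2)) / 2); [field | rewrite H; field]. }
  unfold PVI. repeat split.
  - apply (neq0_factor_r _ 2 _ HT1). field.
  - intros H. apply HT2. transitivity (2 * (1 / 2 + tau - 1)); [field | rewrite H; ring].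
  - apply (neq0_factor_r _ 2 _ HY1). field.
  - intros H. apply HY2. transitivity (2 * (1 / 2 + tau * rho - 1)); [field | rewrite H; ring].
  - intros H. apply Hyt.
    transitivity (2 * (1 / 2 + tau * rho - (1 / 2 + tau))); [field | rewrite H; ring].
  - transitivity ((tau * y2) / tau); [field; exact Ht|].
    rewrite E. unfold Yq, Tq, g. field. repeat split; try assumption.
    + apply (neq0_factor_l _ _ (1 / 4) HY). unfold Yq, g. field.
    + apply (neq0_factor_l _ _ (1 / 4) HT). unfold Tq, g. field.
Qed.

(** * The rational functions of the parametrization *)

(** On the curve [w ^ 2 = pL * pM * pQ]; [pK], [pN], [pD] and [pH] are the other factors of
    [T37] and [y37].  Besides these, [T * (T - 1)], [y * (y - 1)] and [y - T] contribute [pP],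
    [pA], [pB], [pU] and [pV], and the first two derivatives of [y] contribute [pR] and
    [pR']. *)
Definition pL (s : C) : C := s - 2.
Definition pM (s : C) : C := 2 * s + 1.
Definition pQ (s : C) : C := 2 * s ^ 2 + s + 2.
Definition pK (s : C) : C := 4 * s + 1.
Definition pP (s : C) : C := s + 1.
Definition pA (s : C) : C := 8 * s ^ 2 - 2 * s + 17.
Definition pB (s : C) : C := 4 * s ^ 2 - s + 1.
Definition pN (s : C) : C := 32 * s ^ 7 + 32 * s ^ 6 + 138 * s ^ 5 + 25 * s ^ 4 + 130 * s ^ 3
       + 30 * s ^ 2 + 20 * s - 10.
Definition pD (s : C) : C := 64 * s ^ 6 + 336 * s ^ 4 + 104 * s ^ 3 + 36 * s ^ 2 - 132 * s - 59.
Definition pH (s : C) : C := 256 * s ^ 8 - 832 * s ^ 7 - 800 * s ^ 6 - 3232 * s ^ 5 - 1844 * s ^ 4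
       - 2950 * s ^ 3 - 1436 * s ^ 2 - 391 * s + 64.
Definition pU (s : C) : C :=
  2048*s^8 - 3584*s^7 + 512*s^6 - 15488*s^5 - 15232*s^4 - 21800*s^3 - 16780*s^2 - 4790*s -
  901.
Definition pV (s : C) : C := 128*s^5 + 160*s^4 + 80*s^3 + 740*s^2 - 380*s + 629.
Definition pR (s : C) : C :=
  8192*s^12 + 30720*s^11 - 82944*s^10 + 161024*s^9 - 87552*s^8 + 273024*s^7 - 49920*s^6 -
  216720*s^5 - 381888*s^4 - 421516*s^3 - 170376*s^2 - 48465*s - 8569.
Definition pR' (s : C) : C :=
  973078528*s^24 + 2982150144*s^22 - 2401239040*s^21 + 9230745600*s^20 - 1206779904*s^19 +
  41477865472*s^18 + 28673851392*s^17 + 49231798272*s^16 - 28983365632*s^15 -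
  126932576256*s^14 - 274165539840*s^13 - 375725907968*s^12 - 439032107520*s^11 -
  390654074880*s^10 - 300879188224*s^9 - 179932649184*s^8 - 87490586160*s^7 -
  40070583464*s^6 - 17935063956*s^5 - 8527431294*s^4 - 4045362073*s^3 - 1232053398*s^2 -
  210325653*s - 18331262.

Ltac unfold_polys := unfold pL, pM, pQ, pK, pP, pA, pB, pN, pD, pH, pU, pV, pR, pR' in *.

(** Off the zeros of [bad], all denominators below are invertible and [tau2'] does not vanish,
    and [T] differs from [0] and [1], and [y] from [0], [1] and [T]. *)
Definition bad (s : C) : C :=
  pL s * pM s * pQ s * pK s * pP s * pA s * pB s * pN s * pD s * pU s * pV s.

Lemma good_factors (s : C) : bad s <> 0 ->
  pL s <> 0 /\ pM s <> 0 /\ pQ s <> 0 /\ pK s <> 0 /\ pP s <> 0 /\ pA s <> 0 /\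
  pB s <> 0 /\ pN s <> 0 /\ pD s <> 0 /\ pU s <> 0 /\ pV s <> 0.
Proof.
  unfold bad. intros H. repeat split; intros E; apply H; rewrite E; ring.
Qed.

(** [(T - 1/2) ^ 2] as a function on the curve, and its derivative [tau2']. *)
Definition tau2 (s : C) : C := 9 * pN s ^ 2 * pM s / (4 * pL s ^ 5 * pK s ^ 4 * pQ s ^ 3).
Definition tau2' (s : C) : C :=
  - (90 * pN s * pP s ^ 4 * pA s * pB s ^ 2 / (pL s ^ 6 * pQ s ^ 4 * pK s ^ 5)).
(** [(y - 1/2) / (T - 1/2)] as a function on the curve. *)
Definition ratio (s : C) : C := pH s * pL s ^ 2 * pK s * pQ s / (3 * pN s * pD s).
(** [dy/dT] as a function on the curve, and its derivative [slope'] with respect to [s]. *)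
Definition slope (s : C) : C :=
  - (pL s ^ 2 * pQ s * pK s * pR s / (3 * pP s * pD s ^ 2 * pA s * pB s)).
Definition slope' (s : C) : C :=
  - (3 * pL s * pR' s / (pP s ^ 2 * pD s ^ 3 * pA s ^ 2 * pB s ^ 2)).

Lemma strictly_diff_tau2 (s : C) : bad s <> 0 -> strictly_diff tau2 s (tau2' s).
Proof.
  intros H. apply good_factors in H. decompose [and] H.
  unfold tau2, tau2'. unfold_polys.
  eapply strictly_diff_eq; [differentiate; cbv beta; nonzero|].
  cbv beta. simpl Z.of_nat. simpl pred. field. nonzero.
Qed.

(** The derivative is written so that [dy/dT = ratio + tau * ratio' * ds/dT], with
    [ds/dT = 2 * tau / tau2'], visibly equals [slope]. *)
Lemma strictly_diff_ratio (s : C) : bad s <> 0 ->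
  strictly_diff ratio s ((slope s - ratio s) * tau2' s / (2 * tau2 s)).
Proof.
  intros H. apply good_factors in H. decompose [and] H.
  unfold ratio, slope, tau2', tau2. unfold_polys.
  eapply strictly_diff_eq; [differentiate; cbv beta; nonzero|].
  cbv beta. simpl Z.of_nat. simpl pred. field. nonzero.
Qed.

Lemma strictly_diff_slope (s : C) : bad s <> 0 -> strictly_diff slope s (slope' s).
Proof.
  intros H. apply good_factors in H. decompose [and] H.
  unfold slope, slope'. unfold_polys.
  eapply strictly_diff_eq; [differentiate; cbv beta; nonzero|].
  cbv beta. simpl Z.of_nat. simpl pred. field. nonzero.
Qed.

Lemma is_poly_bad : is_poly bad.
Proof. unfold bad. unfold_polys. polynomial. Qed.

Lemma bad_nonzero : exists s, bad s <> 0.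
Proof.
  exists 0.
  replace (bad 0) with (RtoC 22737167480) by (unfold bad; unfold_polys; ring).
  nonzero.
Qed.

(** Over each root of [bad] lie finitely many points of the curve, the solutions [w] of a
    quadratic equation. *)
Lemma almost_all_good (P : C * C -> Prop) :
  (forall p, curve37 p -> bad (fst p) <> 0 -> P p) -> almost_all curve37 P.
Proof.
  intros HP. destruct (finitely_many_roots bad is_poly_bad bad_nonzero) as [R HR].
  assert (HE : exists E : list (C * C), forall p, curve37 p -> In (fst p) R -> In p E).
  { clear HR HP. induction R as [|s R [E HE]]; [exists []; simpl; tauto|].
    destruct (finitely_many_roots (fun w => w ^ 2 - (s - 2) * (2 * s + 1) * (2 * s ^ 2 + s + 2)))
      as [W HW].
    { polynomial. }
    { destruct (excluded_middle_informative ((s - 2) * (2 * s + 1) * (2 * s ^ 2 + s + 2) = 0))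
        as [H|H].
      - exists 1. rewrite H. intros H1. apply C1_nz. rewrite <- H1. ring.
      - exists 0. intros H1. apply H.
        transitivity (- (0 ^ 2 - (s - 2) * (2 * s + 1) * (2 * s ^ 2 + s + 2)));
          [ring | rewrite H1; ring]. }
    exists (map (fun w => (s, w)) W ++ E). intros [s' w] Hp [Hs|HR]; apply in_app_iff.
    - left. simpl in Hs. subst s'. apply (in_map (fun w => (s, w))), HW.
      unfold curve37 in Hp. rewrite Hp. ring.
    - right. apply HE; assumption. }
  destruct HE as [E HE]. exists E. intros p Hp Hnot. apply HP; [exact Hp|].
  intros H. apply Hnot, HE; [exact Hp | apply HR, H].
Qed.

Lemma curve37_w_neq0 (s w : C) : curve37 (s, w) -> bad s <> 0 -> w <> 0.
Proof.
  intros Hp H ->. apply good_factors in H. decompose [and] H.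
  apply (Cmult_neq_0 (pL s * pM s) (pQ s)); [nonzero | assumption |].
  unfold_polys. unfold curve37 in Hp. rewrite <- Hp. ring.
Qed.

Lemma T37_centred (s w : C) :
  T37 (s, w) - 1 / 2 = 3 * pM s * pN s / (2 * pL s ^ 2 * pK s ^ 2 * pQ s * w).
Proof. unfold T37. unfold_polys. unfold Cdiv. ring. Qed.

Lemma T37_centred_sqr (s w : C) : curve37 (s, w) -> bad s <> 0 ->
  (T37 (s, w) - 1 / 2) ^ 2 = tau2 s.
Proof.
  intros Hp H. pose proof (curve37_w_neq0 s w Hp H) as Hw.
  apply good_factors in H. decompose [and] H.
  rewrite T37_centred. unfold tau2.
  transitivity (9 * pM s ^ 2 * pN s ^ 2 / (4 * pL s ^ 4 * pK s ^ 4 * pQ s ^ 2 * w ^ 2));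
    [field; nonzero|].
  replace (w ^ 2) with (pL s * pM s * pQ s) by (symmetry; exact Hp).
  field. nonzero.
Qed.

Lemma y37_ratio (s w : C) : curve37 (s, w) -> bad s <> 0 ->
  y37 (s, w) = 1 / 2 + (T37 (s, w) - 1 / 2) * ratio s.
Proof.
  intros Hp H. pose proof (curve37_w_neq0 s w Hp H) as Hw.
  apply good_factors in H. decompose [and] H.
  rewrite T37_centred.
  change (y37 (s, w)) with (1 / 2 + pM s * pH s / (2 * w * pK s * pD s)).
  unfold ratio. field. nonzero.
Qed.

Lemma tau2_neq0 s : bad s <> 0 -> tau2 s <> 0.
Proof.
  intros H. apply good_factors in H. decompose [and] H. unfold tau2. nonzero.
Qed.

Lemma tau2'_neq0 s : bad s <> 0 -> tau2' s <> 0.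
Proof.
  intros H. apply good_factors in H. decompose [and] H. unfold tau2'. nonzero.
Qed.

(** This is [T * (T - 1)]. *)
Lemma tau2_minus_quarter s : bad s <> 0 ->
  tau2 s - 1 / 4 = pP s ^ 5 * pA s ^ 2 * pB s ^ 3 / (pL s ^ 5 * pQ s ^ 3 * pK s ^ 4).
Proof.
  intros H. apply good_factors in H. decompose [and] H. unfold tau2. unfold_polys. field. nonzero.
Qed.

(** This is [y * (y - 1)]. *)
Lemma tau2_ratio_minus_quarter s : bad s <> 0 ->
  tau2 s * ratio s ^ 2 - 1 / 4 =
  - (5 * pP s ^ 4 * pU s * pB s ^ 2 / (pL s  * pQ s * pK s ^ 2 * pD s ^ 2)).
Proof.
  intros H. apply good_factors in H. decompose [and] H. unfold tau2, ratio. unfold_polys. field. nonzero.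
Qed.

(** This is [(y - T) / (T - 1/2)]. *)
Lemma ratio_minus_1 s : bad s <> 0 ->
  ratio s - 1 = - (2 * pP s ^ 4 * pV s * pB s ^ 2 / (3 * pN s * pD s)).
Proof.
  intros H. apply good_factors in H. decompose [and] H. unfold ratio. unfold_polys. field. nonzero.
Qed.

(** The second derivative is [slope'(s) * ds/dT].  Factoring [Tq], [Yq] and [ratio - 1] first
    keeps the denominators of the final identity products of known factors. *)
Lemma PVI_at (s tau : C) : bad s <> 0 -> tau ^ 2 = tau2 s ->
  PVI (1 / 3) (1 / 3) (1 / 3) (1 / 5) (1 / 2 + tau) (1 / 2 + tau * ratio s) (slope s)
    (slope' s * (2 * tau / tau2' s)).
Proof.
  intros H Ht. pose proof (tau2_neq0 s H) as H2. pose proof (tau2'_neq0 s H) as H2'.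
  pose proof (good_factors s H) as Hf. decompose [and] Hf.
  apply PVI_symmetric; rewrite ?Ht.
  - intros ->. apply H2. rewrite <- Ht. ring.
  - intros Hr.
    assert (E : ratio s - 1 <> 0).
    { rewrite ratio_minus_1 by exact H. nonzero. }
    apply E. rewrite Hr. ring.
  - rewrite tau2_minus_quarter by exact H. nonzero.
  - rewrite tau2_ratio_minus_quarter by exact H. nonzero.
  - transitivity (2 * tau2 s * slope' s / tau2' s).
    { rewrite <- Ht. field. exact H2'. }
    rewrite tau2_minus_quarter, tau2_ratio_minus_quarter, ratio_minus_1 by exact H.
    unfold tau2, ratio, slope, slope', tau2'. unfold_polys. field. nonzero.
Qed.

(** * The solution and the algebraic relation *)

(** A branch of the solution over a neighbourhood of [t0].  The first property says that [Y]
    agrees with [y] at every point of the curve whose [s] is close to [s0], whatever the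
    sign of [w]. *)
Lemma solution_near (s0 t0 : C) : bad s0 <> 0 -> (t0 - 1 / 2) ^ 2 = tau2 s0 ->
  exists Y : C -> C,
    locally s0 (fun s => forall t, (t - 1 / 2) ^ 2 = tau2 s ->
      1 / 2 + (t - 1 / 2) * ratio s = Y t) /\
    PVI_solution_near (1 / 3) (1 / 3) (1 / 3) (1 / 5) Y t0.
Proof.
  intros H0 Ht0.
  destruct (local_inverse tau2 s0 (tau2' s0)) as (G & HGl & HGr).
  { apply strictly_diff_tau2, H0. }
  { apply tau2'_neq0, H0. }
  (* [S] is [s] as a function of [t], since [tau2 (S t) = (t - 1 / 2) ^ 2]. *)
  pose (sq := fun t : C => (t - 1 / 2) ^ 2). pose (S := fun t => G (sq t)).
  assert (Hsq : forall t, strictly_diff sq t (2 * (t - 1 / 2))).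
  { intros t. unfold sq. eapply strictly_diff_eq; [differentiate; apply RtoC_neq0; lra|].
    cbv beta. simpl Z.of_nat. simpl pred. field. }
  exists (fun t => 1 / 2 + (t - 1 / 2) * ratio (S t)). split.
  { revert HGl. apply filter_imp. intros s Hs t Ht. unfold S, sq. rewrite Ht, Hs. reflexivity. }
  exists (fun t => slope (S t)), (fun t => slope' (S t) * (2 * (t - 1 / 2) / tau2' (S t))).
  assert (HG0 : G (tau2 s0) = s0) by exact (locally_singleton _ _ HGl).
  assert (Hbad : locally (tau2 s0) (fun u => bad (G u) <> 0)).
  { apply (locally_neq0 (fun u => bad (G u))); [|rewrite HG0; exact H0].
    apply (continuous_comp G bad).
    - apply (locally_singleton _ _ HGr).
    - apply is_poly_continuous, is_poly_bad. }
  assert (Hu : locally (sq t0) (fun u => bad (G u) <> 0 /\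
    locally u (fun v => tau2 (G v) = v /\ continuous G v))).
  { unfold sq. rewrite Ht0. apply filter_and; [exact Hbad | apply locally_locally, HGr]. }
  apply (strictly_diff_continuous _ _ _ (Hsq t0)) in Hu. unfold filtermap in Hu.
  revert Hu. apply filter_imp. intros t [Hb Hloc].
  change (G (sq t)) with (S t) in Hb.
  destruct (locally_singleton _ _ Hloc) as [Hinv Hcont].
  change (G (sq t)) with (S t) in Hinv.
  assert (HS : strictly_diff S t (2 * (t - 1 / 2) / tau2' (S t))).
  { eapply strictly_diff_eq.
    - apply (strictly_diff_comp G sq); [apply Hsq|].
      apply (strictly_diff_inverse tau2 G (sq t) (tau2' (S t))).
      + exact Hcont.
      + revert Hloc. apply filter_imp. intros v Hv. apply Hv.
      + apply strictly_diff_tau2, Hb.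
      + apply tau2'_neq0, Hb.
    - field. apply tau2'_neq0, Hb. }
  split; [|split].
  - apply strictly_diff_is_derive. eapply strictly_diff_eq.
    + apply strictly_diff_plus; [apply strictly_diff_const|].
      apply (strictly_diff_mult (fun t => t - 1 / 2) (fun t => ratio (S t))).
      * apply strictly_diff_minus; [apply strictly_diff_id | apply strictly_diff_const].
      * apply (strictly_diff_comp ratio S); [exact HS | apply strictly_diff_ratio, Hb].
    + cbv beta. pose proof (tau2_neq0 _ Hb). pose proof (tau2'_neq0 _ Hb).
      transitivity (ratio (S t) + (slope (S t) - ratio (S t)) * (sq t / tau2 (S t))).
      * unfold sq. field. split; assumption.
      * rewrite Hinv. field. rewrite <- Hinv. assumption.
  - apply strictly_diff_is_derive.
    apply (strictly_diff_comp slope S); [exact HS | apply strictly_diff_slope, Hb].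
  - replace t with (1 / 2 + (t - 1 / 2)) at 1 by ring.
    apply PVI_at; [exact Hb | symmetry; exact Hinv].
Qed.

Lemma exists_large_real (E : list C) : exists x : R, (2 < x)%R /\ ~ In (RtoC x) E.
Proof.
  assert (HM : exists M : R, forall z, In z E -> (fst z < M)%R).
  { induction E as [|z E [M HM]]; [exists 0%R; simpl; tauto|].
    exists (Rmax M (fst z + 1)). intros z' [<-|Hz'].
    - pose proof (Rmax_r M (fst z + 1)). lra.
    - pose proof (Rmax_l M (fst z + 1)). specialize (HM z' Hz'). lra. }
  destruct HM as [M HM]. exists (Rmax M 3).
  pose proof (Rmax_l M 3). pose proof (Rmax_r M 3). split; [lra|].
  intros HE. specialize (HM _ HE). simpl in HM. lra.
Qed.

Lemma curve37_real (x : R) : (2 < x)%R ->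
  exists w, curve37 (RtoC x, w) /\ curve37 (RtoC x, - w).
Proof.
  intros Hx. pose (q := ((x - 2) * (2 * x + 1) * (2 * x ^ 2 + x + 2))%R).
  assert (Hq : (0 <= q)%R) by (unfold q; repeat apply Rmult_le_pos; nra).
  assert (E : RtoC (sqrt q) ^ 2 =
    (RtoC x - 2) * (2 * RtoC x + 1) * (2 * RtoC x ^ 2 + RtoC x + 2)).
  { rewrite <- RtoC_pow, pow2_sqrt by exact Hq. unfold q.
    rewrite !RtoC_mult, RtoC_minus, !RtoC_plus, !RtoC_mult, RtoC_pow. reflexivity. }
  exists (RtoC (sqrt q)). unfold curve37. split; [exact E|].
  rewrite <- E. ring.
Qed.

Lemma T37_nonconstant : nonconstant_on curve37 T37.
Proof.
  intros (c & E & HE).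
  destruct (finitely_many_roots bad is_poly_bad bad_nonzero) as [R HR].
  destruct (exists_large_real (R ++ map fst E)) as (x & Hx & Hnot).
  destruct (curve37_real x Hx) as (w & Hw & Hw').
  assert (HxE : forall v, ~ In (RtoC x, v) E).
  { intros v Hv. apply Hnot, in_app_iff. right. exact (in_map fst _ _ Hv). }
  assert (Hb : bad x <> 0).
  { intros H. apply Hnot, in_app_iff. left. apply HR, H. }
  pose proof (HE _ Hw (HxE w)) as H1. pose proof (HE _ Hw' (HxE (- w))) as H2.
  pose proof (curve37_w_neq0 _ _ Hw Hb) as Hw0.
  pose proof (good_factors _ Hb) as Hf. decompose [and] Hf.
  apply (tau2_neq0 _ Hb).
  rewrite <- (T37_centred_sqr _ _ Hw Hb).
  assert (Hsym : T37 (RtoC x, - w) - 1 / 2 = - (T37 (RtoC x, w) - 1 / 2)).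
  { rewrite !T37_centred. field. nonzero. }
  rewrite H1, H2 in *.
  assert (Hc : c - 1 / 2 = 0).
  { transitivity ((c - 1 / 2 - - (c - 1 / 2)) / 2); [field | rewrite <- Hsym; field]. }
  rewrite Hc. ring.
Qed.

Theorem mainTheorem5 :
  parametrizes_PVI_solution (1 / 3) (1 / 3) (1 / 3) (1 / 5) curve37 T37 y37 /\
  algebraically_related_on curve37 T37 y37.
Proof.
  split; [split; [exact T37_nonconstant|]|].
  - apply almost_all_good. intros [s0 w0] Hp Hb. simpl fst in Hb.
    destruct (solution_near s0 (T37 (s0, w0)) Hb (T37_centred_sqr _ _ Hp Hb)) as (Y & HY & Hsol).
    exists Y. split; [|exact Hsol].
    assert (Hgood : locally s0 (fun s => bad s <> 0)).
    { apply locally_neq0; [apply is_poly_continuous, is_poly_bad | exact Hb]. }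
    pose proof (continuous_fst (U := C_UniformSpace) (V := C_UniformSpace) s0 w0 _
      (filter_and _ _ HY Hgood)) as Hnear.
    unfold filtermap in Hnear. revert Hnear. apply filter_imp. intros [s w] [H1 H2] Hq. simpl in H1, H2.
    exact (eq_trans (y37_ratio s w Hq H2) (H1 _ (T37_centred_sqr s w Hq H2))).
  - pose (X := {p : C * C | curve37 p /\ bad (fst p) <> 0}).
    destruct (algebraic_dependence (X := X)
      (fun p => fst (proj1_sig p)) (fun p => T37 (proj1_sig p) - 1 / 2)
      (fun p => T37 (proj1_sig p)) (fun p => y37 (proj1_sig p))
      (* The common denominator of [tau2] and [ratio], then the numerators of [tau2], [T], [y]. *)
      (fun s => 12 * pL s ^ 5 * pK s ^ 4 * pQ s ^ 3 * pN s * pD s)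
      (fun s => 27 * pN s ^ 3 * pM s * pD s)
      (fun s => 6 * pL s ^ 5 * pK s ^ 4 * pQ s ^ 3 * pN s * pD s)
      (fun s => 12 * pL s ^ 5 * pK s ^ 4 * pQ s ^ 3 * pN s * pD s)
      (fun s => 6 * pL s ^ 5 * pK s ^ 4 * pQ s ^ 3 * pN s * pD s)
      (fun s => 4 * pL s ^ 7 * pK s ^ 5 * pQ s ^ 4 * pH s))
      as (N & c & Hc & Hrel).
    1-6: unfold_polys; polynomial.
    1-4: intros [[s w] [Hp Hb]]; simpl proj1_sig; simpl fst in *;
      pose proof (good_factors _ Hb) as Hf; decompose [and] Hf.
    + nonzero.
    + rewrite (T37_centred_sqr _ _ Hp Hb). unfold tau2. field. nonzero.
    + field.
    + rewrite (y37_ratio _ _ Hp Hb). unfold ratio. field. nonzero.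
    + exists N, c. split; [exact Hc|].
      apply almost_all_good. intros p Hp Hb. exact (Hrel (exist _ p (conj Hp Hb))).
Qed.
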